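(* For strongly zero-dimensional locally compact spaces $X$ and $Y$ the following conditions are equivalent. (1) $\mathcal T_K(X)$ and $\mathcal T_K(Y)$ are order-isomorphic; (2) $X^*$ and $Y^*$ are homeomorphic.
   Context: Locally compact spaces and compact spaces are assumed Hausdorff. A Tychonoff space $X$ is strongly zero-dimensional if its Stone-Čech compactification $\beta X$ is zero-dimensional, i.e. the clopen subsets of $\beta X$ form an open base. $X^*=\beta X\setminus X$. For a Tychonoff space $X$, a one-point extension of $X$ is a Tychonoff space $T$ containing $X$ as a dense subspace such that $T\setminus X$ is a singleton. Two extensions are identified if there is a homeomorphism between them fixing $X$ pointwise. For extensions $T_1,T_2$ of $X$, $T_2\leq T_1$ means there is a continuous $f:T_1\to T_2$ fixing $X$ pointwise; this is a partial order on the set $\mathcal T(X)$ of all (equivalence classes of) one-point extensions of $X$. $\mathcal T_K(X)=\{T\in\mathcal T(X): T\text{ is locally compact}\}$ with the induced order. Partially ordered sets are order-isomorphic if there is a bijection between them that is order-preserving with order-preserving inverse. *)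

(* Defs.v *)
From HB Require Import structures.
From mathcomp Require Import all_boot all_order all_algebra.
From mathcomp Require Import all_classical all_reals.
From mathcomp Require Import topology normedtype.

Set Implicit Arguments.
Unset Strict Implicit.
Unset Printing Implicit Defensive.

Import Order.TTheory GRing.Theory Num.Theory.
Import numFieldNormedType.Exports.

Local Open Scope classical_set_scope.
Local Open Scope ring_scope.

Definition homeomorphism {X Y : topologicalType} (f : X -> Y) : Prop :=
  continuous f /\
  exists g : Y -> X, [/\ continuous g, cancel f g & cancel g f].

Definition homeomorphic (X Y : topologicalType) : Prop :=
  exists f : X -> Y, homeomorphism f.

Definition tychonoff_space (X : topologicalType) : Prop :=
  hausdorff_space X /\ completely_regular_space X.

Definition locally_compact_space (X : topologicalType) : Prop :=
  hausdorff_space X /\ locally_compact [set: X].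

(* The library's [zero_dimensional] only separates points by clopen sets. *)
Definition has_clopen_base (X : topologicalType) : Prop :=
  forall (x : X) (U : set X), nbhs x U ->
    exists V : set X, [/\ clopen V, V x & V `<=` U].

(* The Stone-Cech compactification is the closure of the image of [X] in the
   Tychonoff cube indexed by the continuous functions from [X] to [0, 1]. *)
Section StoneCech.
Context (R : realType) (X : topologicalType).

Definition unit_interval : topologicalType := set_type (`[0, 1] : set R).

Definition tychonoff_cube : topologicalType :=
  prod_topology (fun _ : continuousType X unit_interval => unit_interval).

Definition evaluation (x : X) : tychonoff_cube :=
  fun f : continuousType X unit_interval => f x.

Definition stone_cech : topologicalType :=
  set_type (closure (range evaluation)).

Definition stone_cech_map (x : X) : stone_cech :=
  exist _ (evaluation x)
    (mem_set (@subset_closure _ (range evaluation) _ (imageT evaluation x))).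

Definition stone_cech_remainder : topologicalType :=
  set_type (~` range stone_cech_map).

Definition strongly_zero_dimensional : Prop :=
  tychonoff_space X /\ has_clopen_base stone_cech.

End StoneCech.

Definition embedding {X Y : topologicalType} (f : X -> Y) : Prop :=
  injective f /\ @open X = @open (initial_topology f).

Record one_point_extension (X : topologicalType) := OnePointExtension {
  ext_space :> topologicalType;
  ext_map : X -> ext_space;
  ext_tychonoff : tychonoff_space ext_space;
  ext_embedding : embedding ext_map;
  ext_dense : dense (range ext_map);
  ext_point : exists p : ext_space, ~` range ext_map = [set p]
}.

Section ExtensionOrder.
Context {X : topologicalType}.
Implicit Types S T : one_point_extension X.

Definition ext_equiv S T : Prop :=
  exists f : S -> T, homeomorphism f /\ forall x, f (ext_map S x) = ext_map T x.

Definition ext_le S T : Prop :=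
  exists f : T -> S, continuous f /\ forall x, f (ext_map T x) = ext_map S x.

Definition ext_class T : one_point_extension X -> Prop :=
  fun S => ext_equiv S T.

End ExtensionOrder.

(* An equivalence class is a bare predicate because [set] lives in too small a
   universe to be applied to [one_point_extension X]. *)
Definition ext_classes (X : topologicalType) : Type :=
  {C : one_point_extension X -> Prop |
    exists T : one_point_extension X, C = ext_class T}.

Definition ext_classes_le {X : topologicalType} (C D : ext_classes X) : Prop :=
  exists S T, [/\ sval C S, sval D T & ext_le S T].

Definition lc_ext_classes (X : topologicalType) : Type :=
  {C : ext_classes X |
    exists T : one_point_extension X, sval C T /\ locally_compact_space T}.

Definition lc_ext_classes_le {X : topologicalType} (C D : lc_ext_classes X) :
    Prop :=
  ext_classes_le (sval C) (sval D).

Definition order_isomorphic {A B : Type} (leA : A -> A -> Prop)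
    (leB : B -> B -> Prop) : Prop :=
  exists (f : A -> B) (g : B -> A),
    [/\ cancel f g, cancel g f,
        forall x y, leA x y -> leB (f x) (f y) &
        forall x y, leB x y -> leA (g x) (g y)].

(* Main.v *)
From HB Require Import structures.
Require Import Defs.
From mathcomp Require Import all_boot all_order all_algebra.
From mathcomp Require Import all_classical all_reals.
From mathcomp Require Import topology normedtype.

(** Write [K] for the Stone-Cech compactification of [X], [Z] for the remainder
    of [X] in [K], and let [T] be a one-point extension of [X] with added point
    [p]. The inclusion of [X] in [T] extends to a continuous map from [K] to
    the Stone-Cech compactification of [T]; call the preimage of [p], a closed
    subset of [Z], the limit set of [T]. It is described without that map, as
    the set of the points of [Z] whose trace on [X] converges to [p] in [T].

    The limit set determines [T] and its place in the order: [S] lies below [T]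
    exactly if the limit set of [S] contains that of [T] ([ext_leP]). One
    direction composes limits with the map from [T] to [S]; in the other the
    map exists because a filter converging to [p] accumulates in [K] only at
    points of the limit set of [T], by compactness ([added_cluster]).

    If [T] is locally compact, its limit set is clopen in [Z]
    ([limit_set_open]). Conversely, since [X] is locally compact, [Z] is closed
    in [K], hence compact; since [K] has a base of clopen sets, a clopen subset
    of [Z] is the part in [Z] of a clopen subset [U] of [K]. Attaching one
    point at the end of the trace of [U] on [X] gives a locally compact
    extension with that limit set ([clopen_limit_set]). So the locally compact
    one-point extensions form the set of nonempty clopen subsets of [Z] under
    reverse inclusion ([lc_ext_classes_clopens]).

    This ordered set determines [Z] and is determined by it, by Stone duality
    without the empty set: a point of a compact zero-dimensional Hausdorff
    space is an ultrafilter of clopen sets, and being such an ultrafilter is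
    expressed by the order alone ([nonempty_clopen_homeomorphic]). *)

Set Implicit Arguments.
Unset Strict Implicit.
Unset Printing Implicit Defensive.

Import Order.TTheory GRing.Theory Num.Theory.
Import numFieldNormedType.Exports.

Local Open Scope classical_set_scope.
Local Open Scope ring_scope.

(** * Initial topologies and traces of neighbourhood filters *)

(** For a continuous map this says that [S] has the initial topology; it is the
    form in which embeddings are used below. *)
Definition reflects_nbhs {S T : topologicalType} (f : S -> T) : Prop :=
  forall x U, nbhs x U -> exists2 W, nbhs (f x) W & f @^-1` W `<=` U.

Lemma initial_reflects_nbhs (S : choiceType) (T : topologicalType)
  (f : S -> T) : @reflects_nbhs (initial_topology f) T f.
Proof.
move=> x U [_ /= [[W oW <-] Wx WU]].
by exists W => //; exact: open_nbhs_nbhs.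
Qed.

Lemma set_val_reflects_nbhs (T : topologicalType) (A : set T) :
  reflects_nbhs (set_val : A -> T).
Proof. exact: initial_reflects_nbhs. Qed.

Lemma set_val_continuous (T : topologicalType) (A : set T) :
  continuous (set_val : A -> T).
Proof. exact: initial_continuous. Qed.

Lemma injective_hausdorff (S T : topologicalType) (f : S -> T) :
  hausdorff_space T -> continuous f -> injective f -> hausdorff_space S.
Proof.
move=> hT cf injf x y xy; apply/injf/hT => U V fxU fyV.
by have [z [Uz Vz]] := xy _ _ (cf x _ fxU) (cf y _ fyV); exists (f z).
Qed.

Lemma reflects_compact (S T : topologicalType) (f : S -> T) :
  reflects_nbhs f -> compact (range f) -> compact [set: S].
Proof.
move=> rf crf F FF _.
have [_ [[x _ <-] fx]] : range f `&` cluster (f @ F) !=set0.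
  by apply: crf; apply: (@filterS _ F _ setT) filterT => x _; exists x.
exists x; split=> // A B FA /rf[W Wfx WB].
have [|_ [[y Ay <-] Wfy]] := fx (f @` A) W _ Wfx.
  by apply: (@filterS _ F _ A) FA => y Ay; exists y.
by exists y; split=> //; apply: WB.
Qed.

Lemma compact_set_type (T : topologicalType) (A : set T) :
  compact A -> compact [set: A].
Proof.
move=> cA; apply: (reflects_compact (@set_val_reflects_nbhs _ A)).
rewrite (_ : range _ = A)// eqEsubset; split=> [_ [x _ <-]|x Ax].
  exact: set_valP.
by exists (exist _ x (mem_set Ax)).
Qed.

Lemma compactT_closed (T : topologicalType) (A : set T) :
  compact [set: T] -> closed A -> compact A.
Proof. by move=> cT cA; apply: (subclosed_compact cA cT). Qed.

(** Neighbourhoods of [f x] pull back to arbitrarily small neighbourhoods of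
    [x], so [F] clusters at [x] and [g @ F] at [g x]. This is what keeps the
    points added by different extensions of [X] apart from those of [X]. *)
Lemma limit_at_cluster (X A B : topologicalType) (f : X -> A) (g : X -> B)
    (F : set_system X) (x : X) (b : B) :
  hausdorff_space B -> reflects_nbhs f -> continuous g -> ProperFilter F ->
  cluster (f @ F) (f x) -> g @ F --> b -> b = g x.
Proof.
move=> hB rf cg FF clf Fb; apply: hB => P Q bP /cg/rf[W Wfx WQ].
have [|_ [[y Py <-] Wfy]] := clf (f @` (g @^-1` P)) W _ Wfx.
  by apply: (@filterS _ F _ (g @^-1` P)) (Fb _ bP) => y Py; exists y.
by exists (g y); split=> //; apply: (WQ y).
Qed.

Definition trace_filter {X T : topologicalType} (f : X -> T) (t : T) :
  set_system X := filter_from (nbhs t) (preimage f).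

Lemma dense_nbhs (X T : topologicalType) (f : X -> T) (t : T) (U : set T) :
  dense (range f) -> nbhs t U -> exists x, U (f x).
Proof.
move=> df; rewrite nbhsE => -[O [oO Ot] OU].
have [|y [Oy [x _ xy]]] := df O _ oO; first by exists t.
by exists x; apply: OU; rewrite xy.
Qed.

Lemma trace_filter_proper (X T : topologicalType) (f : X -> T) (t : T) :
  dense (range f) -> ProperFilter (trace_filter f t).
Proof.
move=> df; apply: filter_from_proper; last by move=> U /(dense_nbhs df).
apply: filter_from_filter; first by exists setT; exact: filterT.
by move=> U V tU tV; exists (U `&` V); first exact: filterI.
Qed.

Lemma trace_filter_cvg (X T : topologicalType) (f : X -> T) (t : T) :
  f @ trace_filter f t --> t.
Proof. by move=> U tU; exists U. Qed.

Lemma openP_reflects (X T : topologicalType) (f : X -> T) :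
  continuous f -> reflects_nbhs f -> @open X = @open (initial_topology f).
Proof.
move=> cf rf; rewrite eqEsubset; split=> U oU; last first.
  by case: oU => W oW <-; apply: open_comp => // x _; apply: cf.
exists (\bigcup_(W in [set W | open W /\ f @^-1` W `<=` U]) W).
  by apply: bigcup_open => W [].
rewrite eqEsubset; split=> [x [W [_ WU] Wx]|x Ux]; first exact: WU.
have [W] := rf x U (open_nbhs_nbhs (conj oU Ux)).
rewrite nbhsE => -[O [oO Ox] OW] WU.
by exists O => //; split=> // y Oy; apply/WU/OW.
Qed.

Lemma embedding_reflects (X T : topologicalType) (f : X -> T) :
  embedding f -> continuous f /\ reflects_nbhs f.
Proof.
case=> _ fE; split=> [|x U].
  by apply/continuousP => W oW; rewrite fE; exists W.
rewrite nbhsE => -[V [+ Vx] VU]; rewrite fE => -[W oW WV].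
rewrite -WV in Vx VU.
by exists W => //; exact: open_nbhs_nbhs.
Qed.

(** Otherwise the parts of [A] left uncovered by clopen subsets of [O] form a
    filter base with a cluster point in [A], and that point has itself a clopen
    neighbourhood inside [O]. *)
Lemma compact_clopen_between (T : topologicalType) (A O : set T) :
  has_clopen_base T -> compact A -> open O -> A `<=` O ->
  exists U, [/\ clopen U, A `<=` U & U `<=` O].
Proof.
move=> bT cA oO AO; apply: contrapT => noU.
pose F := filter_from [set U | clopen U /\ U `<=` O] (fun U => A `\` U).
have FF : ProperFilter F.
  apply: filter_from_proper => [|U [cU UO]].
    apply: filter_from_filter.
      by exists set0; split; [exact: clopen0|exact: sub0set].
    move=> U V [cU UO] [cV VO]; exists (U `|` V).
      by split; [exact: clopenU|rewrite subUset].
    by rewrite setDUr.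
  by apply/set0P/eqP; rewrite setD_eq0 => AU; apply: noU; exists U.
have [|x [Ax clx]] := cA F FF.
  by exists set0; [split; [exact: clopen0|exact: sub0set]|exact: subDsetl].
have [V [cV Vx VO]] := bT x O (open_nbhs_nbhs (conj oO (AO x Ax))).
have [||y [[_ nVy] Vy]] := clx (A `\` V) V; last by [].
- by exists V.
- by apply: open_nbhs_nbhs; split=> //; case: cV.
Qed.

(** * The Stone-Cech compactification *)

(** Being the Stone-Cech compactification, without the cube: what matters is
    that functions into [0, 1] extend. *)
Record is_stone_cech (R : realType) (X K : topologicalType) (i : X -> K) :
    Prop := IsStoneCech {
  sc_hausdorff : hausdorff_space K;
  sc_compact : compact [set: K];
  sc_continuous : continuous i;
  sc_reflects : reflects_nbhs i;
  sc_dense : dense (range i);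
  sc_extend : forall f : X -> R, continuous f -> range f `<=` `[0, 1] ->
    exists2 F : K -> R, continuous F & forall x, F (i x) = f x }.

Section StoneCechCube.
Context {R : realType} {X : topologicalType}.
Local Notation I01 := (unit_interval R).

Lemma unit_interval_compact : compact [set: I01].
Proof. exact/compact_set_type/segment_compact. Qed.

Lemma unit_interval_hausdorff : hausdorff_space I01.
Proof.
apply: (injective_hausdorff (@Rhausdorff R) (@set_val_continuous _ _)).
exact: val_inj.
Qed.

Lemma cube_compact : compact [set: tychonoff_cube R X].
Proof.
have := @tychonoff _ (fun _ : continuousType X I01 => I01) (fun=> setT)
  (fun=> unit_interval_compact).
by rewrite (_ : [set f | _] = setT)// eqEsubset.
Qed.

Lemma cube_hausdorff : hausdorff_space (tychonoff_cube R X).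
Proof. exact: hausdorff_product (fun=> unit_interval_hausdorff). Qed.

Lemma evaluation_continuous : continuous (@evaluation R X).
Proof.
move=> x; apply/cvg_sup => f U [_ [[V oV <-] Vx VU]].
apply: (@filterS _ (nbhs x) _ (f @^-1` V)) => [y Vy|]; first exact: VU.
by apply: (@cts_fun _ _ f); exact: open_nbhs_nbhs.
Qed.

Lemma unit_valued (f : X -> R) : continuous f -> range f `<=` `[0, 1] ->
  exists F : continuousType X I01, forall x, set_val (F x) = f x.
Proof.
move=> cf f01.
pose g x : I01 := exist _ (f x) (mem_set (f01 _ (imageT f x))).
have cg : continuous g by apply: continuous_comp_initial.
by exists (mkcts cg).
Qed.

Lemma coordinate_continuous (F : continuousType X I01) :
  continuous (fun z : stone_cech R X => set_val (set_val z F)).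
Proof.
move=> z; apply: continuous_comp; last exact: set_val_continuous.
apply: (@continuous_comp _ _ _ set_val (fun c : tychonoff_cube R X => c F)).
  exact: set_val_continuous.
exact: (@proj_continuous _ (fun _ : continuousType X I01 => I01) F).
Qed.

Lemma stone_cech_mapP : tychonoff_space X ->
  is_stone_cech R (@stone_cech_map R X).
Proof.
move=> [hX crX]; split.
- apply: (injective_hausdorff cube_hausdorff (@set_val_continuous _ _)).
  exact: val_inj.
- apply/compact_set_type/(compactT_closed cube_compact).
  exact: closed_closure.
- by apply: continuous_comp_initial; exact: evaluation_continuous.
- (* The coordinate at a function vanishing at [x] and equal to 1 off [U]
     cuts out a neighbourhood whose trace is inside [U]. *)
  move=> x U xU.
  have cB : closed (~` U°) by apply: open_closedC; exact: open_interior.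
  have xB : ~ (~` U°) x by move=> /(_ (nbhs_singleton (nbhs_interior xU))).
  have /(@uniform_separatorP _ R)[f [cf f01 f0 f1]] := crX _ _ cB xB.
  have [F FE] := unit_valued cf f01.
  exists [set z : stone_cech R X | set_val (set_val z F) < 1].
    apply: (@coordinate_continuous F _ [set r | r < 1]); apply: open_nbhs_nbhs.
    split; first exact: open_lt.
    by rewrite /= [set_val _]FE (f0 (f x)) ?ltr01//; exists x.
  move=> y /=; rewrite [set_val _]FE => fy; apply: interior_subset.
  by apply: contrapT => nUy; move: fy; rewrite (f1 (f y)) ?ltxx//; exists y.
- move=> O [z Oz] oO.
  have [W zW WO] :=
    @set_val_reflects_nbhs _ _ z O (open_nbhs_nbhs (conj oO Oz)).
  have [_ [[x _ <-] Wx]] := set_valP z W zW.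
  by exists (stone_cech_map R x); split; [exact: WO|exists x].
- move=> f cf f01; have [F FE] := unit_valued cf f01.
  exists (fun z => set_val (set_val z F)); first exact: coordinate_continuous.
  exact: FE.
Qed.

End StoneCechCube.

(** * One-point extensions *)

Section OnePointExtension.
Context {X : topologicalType}.
Implicit Types T : one_point_extension X.

Definition added_point T : T := sval (cid (ext_point T)).

Lemma ext_range T : ~` range (ext_map T) = [set added_point T].
Proof. exact: (svalP (cid (ext_point T))). Qed.

Lemma ext_cases T (t : T) :
  (exists x, ext_map T x = t) \/ t = added_point T.
Proof.
have [[x _ <-]|nt] := pselect (range (ext_map T) t); first by left; exists x.
by right; have : (~` range (ext_map T)) t by []; rewrite ext_range.
Qed.

Lemma ext_map_neq T x : ext_map T x <> added_point T.
Proof.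
move=> xT; have : (~` range (ext_map T)) (added_point T) by rewrite ext_range.
by apply; exists x.
Qed.

Lemma ext_hausdorff T : hausdorff_space T.
Proof. by case: (ext_tychonoff T). Qed.

Lemma ext_continuous T : continuous (ext_map T).
Proof. by case: (embedding_reflects (ext_embedding T)). Qed.

Lemma ext_reflects T : reflects_nbhs (ext_map T).
Proof. by case: (embedding_reflects (ext_embedding T)). Qed.

Lemma ext_injective T : injective (ext_map T).
Proof. by case: (ext_embedding T). Qed.

Lemma ext_range_open T : open (range (ext_map T)).
Proof.
rewrite -[range _]setCK ext_range openC; apply: accessible_closed_set1.
exact/hausdorff_accessible/ext_hausdorff.
Qed.

Lemma ext_nbhs_image T x (U : set X) :
  nbhs x U -> nbhs (ext_map T x) (ext_map T @` U).
Proof.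
move=> /(@ext_reflects T)[W Wx WU].
have rx : nbhs (ext_map T x) (range (ext_map T)).
  by apply: open_nbhs_nbhs; split; [exact: ext_range_open|exists x].
apply: filterS (filterI Wx rx) => t [+ [y _ yt]]; rewrite -yt => Wy.
by exists y => //; apply: WU.
Qed.

Lemma ext_nbhs_added T (V : set T) (U : set X) :
  nbhs (added_point T) V -> ext_map T @^-1` V `<=` U ->
  nbhs (added_point T) (ext_map T @` U `|` [set added_point T]).
Proof.
move=> pV VU; apply: (@filterS _ _ _ V) pV => t.
have [[x <-] Vx|-> _] := ext_cases t; last by right.
by left; exists x => //; apply: VU.
Qed.

Lemma added_trace_proper T :
  ProperFilter (trace_filter (ext_map T) (added_point T)).
Proof. exact/trace_filter_proper/ext_dense. Qed.

Lemma ext_eq_on (S T : one_point_extension X) (f g : S -> T) :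
  continuous f -> continuous g ->
  (forall x, f (ext_map S x) = g (ext_map S x)) -> f =1 g.
Proof.
move=> cf cg fg s; apply: ext_hausdorff => U V /cf sU /cg sV.
have sUV : nbhs s (f @^-1` U `&` g @^-1` V) by apply: filterI.
have [x [Ux Vx]] := dense_nbhs (@ext_dense _ S) sUV.
by exists (f (ext_map S x)); split=> //; rewrite fg.
Qed.

Lemma ext_le_equiv (S T : one_point_extension X) :
  ext_le S T -> ext_le T S -> ext_equiv S T.
Proof.
move=> [f [cf fE]] [g [cg gE]]; exists g; split=> //; split=> //.
exists f; split=> //.
- apply: (@ext_eq_on S S (f \o g) id) => [s|s|x]; last by rewrite /= gE fE.
    by apply: continuous_comp; [exact: cg|exact: cf].
  exact: cvg_id.
- apply: (@ext_eq_on T T (g \o f) id) => [s|s|x]; last by rewrite /= fE gE.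
    by apply: continuous_comp; [exact: cf|exact: cg].
  exact: cvg_id.
Qed.

Lemma ext_equiv_le (S T : one_point_extension X) :
  ext_equiv S T -> ext_le S T /\ ext_le T S.
Proof.
move=> [f [[cf [g [cg fg gf]]] fE]]; split; last by exists f.
by exists g; split=> // x; rewrite -fE fg.
Qed.

(** If the added point were sent to a point [x] of [X], its trace would
    converge to [x] in [S], hence in [X], hence in [T], where it converges to
    the added point. *)
Lemma ext_le_added (S T : one_point_extension X) (f : T -> S) :
  continuous f -> (forall x, f (ext_map T x) = ext_map S x) ->
  f (added_point T) = added_point S.
Proof.
move=> cf fE; have [[x xE]|//] := ext_cases (f (added_point T)).
case: (@ext_map_neq T x); symmetry.
pose F := trace_filter (ext_map T) (added_point T).
have FF : ProperFilter F := added_trace_proper T.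
apply: (limit_at_cluster (@ext_hausdorff T) (@ext_reflects S)
  (@ext_continuous T) FF); last exact: trace_filter_cvg.
rewrite (_ : ext_map S = f \o ext_map T); last by apply/funext => y /=.
move=> A B [V pV VA] /=; rewrite fE xE => /cf pB.
have pVB : nbhs (added_point T) (V `&` f @^-1` B) by apply: filterI.
have [y [Vy By]] := dense_nbhs (@ext_dense _ T) pVB.
by exists (f (ext_map T y)); split=> //; apply: (VA y).
Qed.

End OnePointExtension.
Arguments added_point {X} T.

(** * Limits of the remainder *)

Section Limits.
Context {R : realType} {X K : topologicalType} {i : X -> K}.
Hypothesis sc : is_stone_cech R i.
Local Notation Z := (set_type (~` range i)).
Implicit Types S T : one_point_extension X.

(** The preimage of the added point under the continuous map from [K] to the
    Stone-Cech compactification of [T], expressed inside [K] and [T]. *)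
Definition limit_set T : set Z := [set z |
  ext_map T @ trace_filter i (set_val z) --> added_point T].

Lemma remainder_neq (z : Z) x : set_val z <> i x.
Proof. by move=> zx; apply: (set_valP z); exists x. Qed.

Lemma remainder_lift (k : K) :
  (forall x, k <> i x) -> exists z : Z, set_val z = k.
Proof.
move=> kN; have kZ : (~` range i) k by move=> [x _ xk]; exact: (kN x).
by exists (exist _ k (mem_set kZ)).
Qed.

Let trace_proper k : ProperFilter (trace_filter i k).
Proof. exact/trace_filter_proper/(sc_dense sc). Qed.

(** If [f] separates the added point from the complement of one of its
    neighbourhoods [V], with values 0 and 1, the extension of [f] to [K] cannot
    reach 1 at [z]. It stays below 1 near [z], so the trace of [z] is eventually
    inside [V]. *)
Lemma limit_set_cluster T (z : Z) :
  (forall V W, nbhs (added_point T) V -> nbhs (set_val z) W ->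
    exists x, V (ext_map T x) /\ W (i x)) -> limit_set T z.
Proof.
move=> meet V pV.
have [_ crT] := ext_tychonoff T.
have cB : closed (~` V°) by apply: open_closedC; exact: open_interior.
have pB : ~ (~` V°) (added_point T) by move=> /(_ (nbhs_singleton
  (nbhs_interior pV))).
have /(@uniform_separatorP _ R)[f [cf f01 f0 f1]] := crT _ _ cB pB.
have [||F cF FE] := sc_extend sc (f := f \o ext_map T).
- by move=> x; apply: continuous_comp; [exact: ext_continuous|exact: cf].
- by move=> _ [x _ <-]; apply: f01; exists (ext_map T x).
have fp : f (added_point T) = 0 by apply: f0; exists (added_point T).
have Fz : F (set_val z) < 1.
  rewrite ltNge; apply/negP => Fz.
  have [||x [/= fx Fx]] := meet (f @^-1` [set r | r < 2^-1])
      (F @^-1` [set r | r > 2^-1]).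
  - apply: cf; apply: open_nbhs_nbhs; split; first exact: open_lt.
    by rewrite /= fp invr_gt0 ltr0n.
  - apply: cF; apply: open_nbhs_nbhs; split; first exact: open_gt.
    by apply: lt_le_trans Fz; rewrite invf_lt1 ?ltr1n// ltr0n.
  by move: Fx; rewrite FE /= ltNge => /negP; apply; exact: ltW.
exists (F @^-1` [set r | r < 1]).
  by apply: cF; apply: open_nbhs_nbhs; split; first exact: open_lt.
move=> x /=; rewrite FE /= => fx; apply: interior_subset.
by apply: contrapT => nVx; move: fx; rewrite (f1 (f (ext_map T x))) ?ltxx//.
Qed.

(** A filter on [X] converging to the added point has a cluster point in [K],
    and none in [X]. *)
Lemma added_cluster T (F : set_system X) : ProperFilter F ->
  ext_map T @ F --> added_point T ->
  exists z : Z, cluster (i @ F) (set_val z) /\ limit_set T z.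
Proof.
move=> FF Fp.
have [k [_ clk]] := sc_compact sc (fmap_proper_filter i FF) filterT.
have [x kx|z zk] := remainder_lift (k := k).
  case: (@ext_map_neq _ T x); symmetry.
  rewrite kx in clk.
  exact: (limit_at_cluster (@ext_hausdorff _ T) (sc_reflects sc)
    (@ext_continuous _ T) FF clk).
exists z; rewrite zk; split=> //; apply: limit_set_cluster => V W pV zW.
rewrite zk in zW.
have [|_ [[x Vx <-] Wx]] := clk (i @` (ext_map T @^-1` V)) W _ zW.
  by apply: (@filterS _ F _ (ext_map T @^-1` V)) (Fp _ pV) => x Vx; exists x.
by exists x.
Qed.

Lemma limit_set_neq0 T : limit_set T !=set0.
Proof.
by have [z [_ zT]] := added_cluster (added_trace_proper T)
  (@trace_filter_cvg _ _ _ _); exists z.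
Qed.

Lemma limit_set_closed T : closed (limit_set T).
Proof.
move=> z clz; apply: limit_set_cluster => V W pV.
rewrite nbhsE => -[O [oO Oz] OW].
have [|y [yT Oy]] := clz (set_val @^-1` O).
  by apply: set_val_continuous; exact: open_nbhs_nbhs.
have [W' yW' W'V] := yT _ pV.
have [x [W'x Ox]] := dense_nbhs (sc_dense sc)
  (filterI yW' (open_nbhs_nbhs (conj oO Oy))).
by exists x; split; [exact: W'V|exact: OW].
Qed.

(** If the trace of [z] is eventually inside a compact neighbourhood [N] of
    the added point, then so is that of any nearby [y], and the added point is
    the only point of [N] where it can accumulate. *)
Lemma limit_set_open T : locally_compact_space T -> open (limit_set T).
Proof.
move=> [_ lcT]; rewrite openE => z zT.
have [N] := lcT (added_point T) I; rewrite withinET => pN [cN _].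
have [W zW WN] := zT _ pN; move: zW; rewrite nbhsE => -[O [oO Oz] OW].
apply: (@filterS _ _ _ (set_val @^-1` O)); last first.
  by apply: set_val_continuous; exact: open_nbhs_nbhs.
move=> y Oy; pose F := trace_filter i (set_val y).
have FF : ProperFilter F := trace_proper _.
have [|q [_ clq]] := cN _ (fmap_proper_filter (ext_map T) FF).
  by exists O; [exact: open_nbhs_nbhs|move=> x /OW; exact: WN].
have [[x xq]|qp] := ext_cases q.
  case: (@remainder_neq y x); rewrite -xq in clq.
  exact: (limit_at_cluster (sc_hausdorff sc) (@ext_reflects _ T)
    (sc_continuous sc) FF clq (@trace_filter_cvg _ _ _ _)).
apply: limit_set_cluster => V P pV yP; rewrite -qp in pV.
have [|_ [[x Px <-] Vx]] := clq (ext_map T @` (i @^-1` P)) V _ pV.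
  by exists P => // x Px; exists x.
by exists x.
Qed.

(** Where [limit_set T] is smaller, the trace of the added point of [T] is
    finer: if it were not inside [V], its part outside [V] would accumulate at
    a point [z] of [limit_set T], whose trace lies in [V]. *)
Lemma limit_set_sub_trace S T : limit_set T `<=` limit_set S ->
  forall V, nbhs (added_point S) V ->
  exists2 U, nbhs (added_point T) U & ext_map T @^-1` U `<=` ext_map S @^-1` V.
Proof.
move=> TS V pV; apply: contrapT => noU.
pose F := filter_from (nbhs (added_point T))
  (fun U => ext_map T @^-1` U `\` ext_map S @^-1` V).
have FF : ProperFilter F.
  apply: filter_from_proper => [|U pU].
    apply: filter_from_filter; first by exists setT; exact: filterT.
    move=> U U' pU pU'; exists (U `&` U'); first exact: filterI.
    by move=> x [[Ux U'x] nVx].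
  by apply/set0P/eqP; rewrite setD_eq0 => UV; apply: noU; exists U.
have [|z [clz /TS zS]] := @added_cluster T F FF.
  by move=> U pU; exists U => // x [].
have [W zW WV] := zS _ pV.
have [|_ [[x nVx <-] /WV]] := clz (i @` (~` (ext_map S @^-1` V))) W _ zW.
  by exists setT => [|x [_ nVx]]; [exact: filterT|exists x].
by [].
Qed.

Lemma ext_leP S T : ext_le S T <-> limit_set T `<=` limit_set S.
Proof.
split=> [[f [cf fE]] z zT V|TS].
  rewrite -(ext_le_added cf fE) => /cf/zT[W zW WV].
  by exists W => // x /WV; rewrite /= fE.
pose f t := if pselect (exists x, ext_map T x = t) is left xt
  then ext_map S (sval (cid xt)) else added_point S.
have fE x : f (ext_map T x) = ext_map S x.
  rewrite /f; case: pselect => [xt|[]]; last by exists x.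
  by congr (ext_map S _); apply: (@ext_injective _ T); exact: (svalP (cid xt)).
have fp : f (added_point T) = added_point S.
  by rewrite /f; case: pselect => // -[x xp]; case: (ext_map_neq xp).
exists f; split=> // t.
have [[x <-]|->] := ext_cases t; move=> V.
  rewrite fE => xV.
  have := @ext_nbhs_image _ T _ _ (@ext_continuous _ S x V xV); apply: filterS.
  by move=> t' [y Vy <-]; rewrite /= fE.
rewrite fp => pV; have [U pU UV] := limit_set_sub_trace TS pV.
apply: filterS (ext_nbhs_added pU UV) => t' [[x Vx <-]|->] /=.
  by rewrite fE.
by rewrite fp; exact: nbhs_singleton.
Qed.

End Limits.

(** * Extensions with a prescribed limit set *)

(** The added point is attached at the end of [A]: its neighbourhoods contain
    [A] up to a compact set. Taking the interior makes this a topology for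
    every [A]; if [A] is clopen, the interior is [A] itself. *)
Definition glued {X : Type} (A : set X) : Type := option X.

Section Glued.
Context {X : topologicalType} (A : set X).
Local Notation T := (glued A).

HB.instance Definition _ := Choice.on T.

Definition glued_nbhs (t : T) : set_system T :=
  if t is Some x then Some @ nbhs x
  else filter_from (compact `&` closed)
         (fun C => Some @` (A° `\` C) `|` [set None]).

Let glued_filter (t : T) : ProperFilter (glued_nbhs t).
Proof.
case: t => [x|]; first exact: fmap_proper_filter.
apply: filter_from_proper; last by move=> C _; exists None; right.
apply: filter_from_filter.
  by exists set0; split; [exact: compact0|exact: closed0].
move=> C D [cC clC] [cD clD]; exists (C `|` D).
  by split; [exact: compactU|exact: closedU].
by move=> t [[x [Ax /not_orP[Cx Dx]] <-]|->]; split;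
  [left; exists x|left; exists x|right|right].
Qed.

Let glued_singleton (t : T) U : glued_nbhs t U -> U t.
Proof.
by case: t => [x /= /nbhs_singleton//|[C _]]; apply; right.
Qed.

Let glued_nbhs_nbhs (t : T) U :
  glued_nbhs t U -> glued_nbhs t (glued_nbhs^~ U).
Proof.
case: t => [x /=|]; first exact: nbhs_interior.
move=> [C [cC clC] CU]; exists C => //= t [[x [Ax Cx] <-]|->]; last by exists C.
apply: (@filterS _ (nbhs x) _ (A° `\` C)).
  by move=> y ACy; apply: CU; left; exists y.
apply: open_nbhs_nbhs; split=> //; apply: openI; first exact: open_interior.
exact: closed_openC.
Qed.

HB.instance Definition _ := hasNbhs.Build T glued_nbhs.
HB.instance Definition _ := @Nbhs_isNbhsTopological.Build T
  glued_filter glued_singleton glued_nbhs_nbhs.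

Definition glued_map (x : X) : T := Some x.

Lemma glued_map_continuous : continuous glued_map.
Proof. by move=> x U. Qed.

Lemma glued_map_reflects : reflects_nbhs glued_map.
Proof.
move=> x U xU; exists (glued_map @` U); last by move=> y [z Uz [<-]].
by apply: (@filterS _ (nbhs x) _ U) xU => y Uy; exists y.
Qed.

Lemma glued_hausdorff : locally_compact_space X -> hausdorff_space T.
Proof.
move=> [hX lcX].
have hopc := one_point_compactification_hausdorff lcX hX.
apply: (@injective_hausdorff T _ (id : T -> one_point_compactification X) hopc);
  last exact: inj_id.
move=> [x U //|U [C cC CU]].
exists C => // t [[x [_ Cx] <-]|->]; apply: CU; last by right.
by left; exists x.
Qed.

(** A filter on this set that does not accumulate at the added point contains
    a compact subset of [X]. *)
Lemma glued_compact : clopen A -> compact (glued_map @` A `|` [set None]).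
Proof.
move=> [oA clA] F FF FA; have [clN|] := pselect (cluster F (None : T)).
  by exists None; split=> //; right.
move=> /existsNP[E /existsNP[V /not_implyP[FE /not_implyP[]]]].
move=> [C [cC clC] CV] EV.
have cC' : compact (glued_map @` C).
  apply: continuous_compact cC.
  exact/continuous_subspaceT/glued_map_continuous.
have [|t [[x Cx xt] clt]] := cC' F FF.
  have FF' := @filter_filter _ _ FF.
  apply: filterS (filterI FE FA) => t [Et [[x Ax xt]|t0]].
    exists x => //; apply: contrapT => nCx; apply: EV; exists t; split=> //.
    apply: CV; left; exists x => //; split=> //.
    by rewrite (iffLR (interior_id A)).
  by case: EV; exists t; split=> //; apply: CV; right.
exists t; split=> //; left; exists x => //.
rewrite -xt in clt.
apply: clA => U xU.
have [|s []] := clt _ (glued_map @` U) FA.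
  by apply: (@filterS _ (nbhs x) _ U) xU => y Uy; exists y.
move=> [[y Ay <-]|->] [y' Uy' //]; case=> y'y.
by exists y; split=> //; rewrite -y'y.
Qed.

Lemma glued_locally_compact :
  locally_compact_space X -> clopen A -> locally_compact_space T.
Proof.
move=> lcX clA; have hT := glued_hausdorff lcX; split=> // -[x|] _.
  have [C] := lcX.2 x I; rewrite !withinET => xC [cC _].
  exists (glued_map @` C).
    by apply: (@filterS _ (nbhs x) _ C) xC => y Cy; exists y.
  suff cC' : compact (glued_map @` C) by split=> //; exact: compact_closed.
  apply: continuous_compact cC.
  exact/continuous_subspaceT/glued_map_continuous.
exists (glued_map @` A `|` [set None]).
  rewrite withinET; exists set0.
    by split; [exact: compact0|exact: closed0].
  move=> t [[x [Ax _] <-]|->]; [left|by right].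
  by exists x => //; exact: interior_subset.
by have cA := glued_compact clA; split=> //; exact: compact_closed.
Qed.

Lemma glued_tychonoff (R : realType) :
  locally_compact_space X -> clopen A -> tychonoff_space T.
Proof.
move=> lcX clA; have [hT lcT] := glued_locally_compact lcX clA.
by split=> //; exact: (locally_compact_completely_regular (R := R) lcT hT).
Qed.

Lemma glued_embedding : embedding glued_map.
Proof.
split; first by move=> x y [].
exact: openP_reflects glued_map_continuous glued_map_reflects.
Qed.

(** A relatively compact [A] would leave the added point isolated. *)
Lemma glued_dense : open A ->
  (forall C, compact C -> closed C -> exists2 x, A x & ~ C x) ->
  dense (range glued_map).
Proof.
move=> oA AC O [[x|] Ot oO].
  by exists (glued_map x); split=> //; exists x.
have [C [cC clC] CO] : nbhs (None : T) O by apply: open_nbhs_nbhs.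
have [x Ax Cx] := AC C cC clC.
exists (glued_map x); split; last by exists x.
apply: CO; left; exists x => //; split=> //.
by rewrite (iffLR (interior_id A)).
Qed.

Lemma glued_point : exists p, ~` range glued_map = [set p].
Proof.
exists None; rewrite eqEsubset; split=> [[x []|//]|_ -> [x _]//].
by exists x.
Qed.

Definition glued_extension (R : realType) (lcX : locally_compact_space X)
    (clA : clopen A)
    (AC : forall C, compact C -> closed C -> exists2 x, A x & ~ C x) :
    one_point_extension X :=
  OnePointExtension (glued_tychonoff R lcX clA) glued_embedding
    (glued_dense clA.1 AC) glued_point.

End Glued.

Section Realization.
Context {R : realType} {X K : topologicalType} {i : X -> K}.
Hypothesis sc : is_stone_cech R i.
Hypothesis lcX : locally_compact_space X.
Local Notation Z := (set_type (~` range i)).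

Lemma compact_image_closed (C : set X) : compact C -> closed (i @` C).
Proof.
move=> cC; apply: (compact_closed (sc_hausdorff sc)).
by apply: continuous_compact cC; exact/continuous_subspaceT/(sc_continuous sc).
Qed.

(** A compact neighbourhood [N] of [x] has closed image. As [X] is dense, that
    image contains any open set whose trace lies in [N]. *)
Lemma stone_cech_range_open : open (range i).
Proof.
rewrite openE => _ [x _ <-].
have [N] := lcX.2 x I; rewrite withinET => xN [cN _].
have [W] := sc_reflects sc xN; rewrite nbhsE => -[O [oO Ox] OW] WN.
rewrite /interior nbhsE; exists O => // k Ok.
suff [y _ <-] : (i @` N) k by exists y.
apply: (compact_image_closed cN) => V kV.
have [y [Oy Vy]] := dense_nbhs (sc_dense sc)
  (filterI (open_nbhs_nbhs (conj oO Ok)) kV).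
by exists (i y); split=> //; exists y => //; apply/WN/OW.
Qed.

Lemma remainder_compact : compact [set: Z].
Proof.
apply/compact_set_type/(compactT_closed (sc_compact sc)).
exact/open_closedC/stone_cech_range_open.
Qed.

Lemma remainder_hausdorff : hausdorff_space Z.
Proof.
apply: (injective_hausdorff (sc_hausdorff sc) (@set_val_continuous _ _)).
exact: val_inj.
Qed.

(** The remainder being closed in [K], a clopen subset of it and its complement
    are compact, so a clopen subset of [K] separates them. *)
Lemma remainder_clopen_extends (C : set Z) : has_clopen_base K -> clopen C ->
  exists2 U, clopen U & set_val @^-1` U = C.
Proof.
move=> zdK [oC clC].
have cimage (B : set Z) : closed B -> compact (set_val @` B).
  move=> /(compactT_closed remainder_compact) cB.
  apply: (continuous_compact _ cB).
  exact/continuous_subspaceT/set_val_continuous.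
have oO : open (~` (set_val @` (~` C))).
  apply: closed_openC; apply: (compact_closed (sc_hausdorff sc)).
  by apply: cimage; exact: open_closedC.
have [|U [cU CU UO]] := compact_clopen_between zdK (cimage _ clC) oO.
  by move=> _ [z Cz <-] [y nCy /val_inj yz]; apply: nCy; rewrite yz.
exists U => //; rewrite eqEsubset; split=> [z Uz|z Cz]; last first.
  by apply: CU; exists z.
by apply: contrapT => nCz; apply: (UO _ Uz); exists z.
Qed.

(** For a clopen [U] of [K], gluing a point at the end of the trace of [U]
    collapses the part of the remainder inside [U]. *)
Lemma clopen_limit_set (C : set Z) : has_clopen_base K -> clopen C ->
  C !=set0 -> exists2 T : one_point_extension X,
    locally_compact_space T & limit_set T = C.
Proof.
move=> zdK cC [z0 Cz0]; have [U cU UC] := remainder_clopen_extends zdK cC.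
rewrite -UC in Cz0.
pose A := i @^-1` U.
have cA : clopen A by apply: preimage_clopen => //; exact: sc_continuous sc.
have escape (z : Z) (B : set X) : U (set_val z) -> compact B ->
    nbhs (set_val z) (U `\` i @` B).
  move=> Uz cB; apply: open_nbhs_nbhs; split.
    by apply: openI; [case: cU|exact/closed_openC/compact_image_closed].
  by split=> // -[x _ xz]; apply: (@remainder_neq _ _ i z x).
have AC B : compact B -> closed B -> exists2 x, A x & ~ B x.
  move=> cB _.
  have [x [Ux nBx]] := dense_nbhs (sc_dense sc) (escape _ _ Cz0 cB).
  by exists x => // Bx; apply: nBx; exists x.
exists (glued_extension R lcX cA AC); first exact: glued_locally_compact.
set T := glued_extension _ _ _ _.
have pN : added_point T = None.
  have : (~` range (ext_map T)) (None : glued A) by move=> [x].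
  by rewrite ext_range => ->.
rewrite -UC eqEsubset; split=> z.
  rewrite /limit_set /= pN => zT.
  have [|W zW WA] := zT (glued_map A @` A `|` [set None]).
    exists set0; first by split; [exact: compact0|exact: closed0].
    move=> t [[x [Ax _] <-]|->]; [left|by right].
    by exists x => //; exact: interior_subset.
  apply: contrapT => nUz.
  have [|x [Wx nUx]] :=
      @dense_nbhs _ _ _ (set_val z) (W `&` ~` U) (sc_dense sc).
    apply: filterI => //; apply: open_nbhs_nbhs; split=> //.
    by apply: closed_openC; case: cU.
  by case: (WA x Wx) => [[y Ay [yx]]|//]; apply: nUx; rewrite -yx.
move=> /= Uz; rewrite /limit_set /= pN => V [B [cB _] BV].
exists (U `\` i @` B); first exact: escape.
move=> x [Ux nBx]; apply: BV; left; exists x => //; split.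
  by rewrite (iffLR (interior_id A) cA.1).
by move=> Bx; apply: nBx; exists x.
Qed.

End Realization.

(** * Order isomorphisms *)

Section OrderIsomorphic.
Context {A B C : Type} {leA : A -> A -> Prop} {leB : B -> B -> Prop}
  {leC : C -> C -> Prop}.

Lemma order_isomorphic_sym :
  order_isomorphic leA leB -> order_isomorphic leB leA.
Proof. by move=> [f [g [fg gf fle gle]]]; exists g, f. Qed.

Lemma order_isomorphic_trans :
  order_isomorphic leA leB -> order_isomorphic leB leC ->
  order_isomorphic leA leC.
Proof.
move=> [f [g [fg gf fle gle]]] [f' [g' [fg' gf' fle' gle']]].
exists (f' \o f), (g \o g'); split=> [x|x|x y /fle/fle'|x y /gle'/gle] //=.
  by rewrite fg'.
by rewrite gf.
Qed.

Lemma order_embedding_isomorphic (f : A -> B) :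
  injective f -> (forall b, exists a, f a = b) ->
  (forall x y, leA x y <-> leB (f x) (f y)) -> order_isomorphic leA leB.
Proof.
move=> injf surjf fle; pose g b := sval (cid (surjf b)).
have gf b : f (g b) = b := svalP (cid (surjf b)).
exists f, g; split=> // [a|x y|x y].
- exact/injf/gf.
- by move=> /fle.
- by move=> xy; apply/fle; rewrite !gf.
Qed.

End OrderIsomorphic.

(** * The order on locally compact extensions *)

Definition nonempty_clopen (Z : topologicalType) : Type :=
  {C : set Z | clopen C /\ C !=set0}.

Lemma nonempty_clopen_eq (Z : topologicalType) (C D : nonempty_clopen Z) :
  sval C = sval D -> C = D.
Proof.
by move=> CD; apply: eq_sig_hprop => // ? ? ?; exact: Prop_irrelevance.
Qed.

Definition clopen_ge {Z : topologicalType} (C D : nonempty_clopen Z) : Prop :=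
  sval D `<=` sval C.

Section ClassesAsClopens.
Context {R : realType} {X K : topologicalType} {i : X -> K}.
Hypothesis sc : is_stone_cech R i.
Hypothesis lcX : locally_compact_space X.
Hypothesis zdK : has_clopen_base K.
Local Notation Z := (set_type (~` range i)).
Local Notation limit_set := (@limit_set X K i).

Lemma ext_equivP (S T : one_point_extension X) :
  ext_equiv S T <-> limit_set S = limit_set T.
Proof.
split=> [/ext_equiv_le[/(ext_leP sc) TS /(ext_leP sc) ST]|ST].
  by rewrite eqEsubset.
by apply: ext_le_equiv; apply/(ext_leP sc); rewrite ST.
Qed.

Lemma ext_classP (c : ext_classes X) (S : one_point_extension X) :
  sval c S -> forall T, sval c T <-> limit_set T = limit_set S.
Proof.
case: c => /= _ [T0 ->] /ext_equivP ST0 T.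
by rewrite ST0; exact: ext_equivP.
Qed.

Definition class_representative (c : lc_ext_classes X) :
    one_point_extension X := sval (cid (svalP c)).

Lemma class_representative_in c : sval (sval c) (class_representative c).
Proof. by have [] := svalP (cid (svalP c)). Qed.

Lemma class_representative_lc c :
  locally_compact_space (class_representative c).
Proof. by have [] := svalP (cid (svalP c)). Qed.

Lemma class_limit_clopen c :
  clopen (limit_set (class_representative c)) /\
  limit_set (class_representative c) !=set0.
Proof.
split; last exact: (limit_set_neq0 sc).
split; last exact: (limit_set_closed sc).
exact/(limit_set_open sc)/class_representative_lc.
Qed.

Definition class_limit (c : lc_ext_classes X) : nonempty_clopen Z :=
  exist _ _ (class_limit_clopen c).

Lemma class_limit_injective : injective class_limit.
Proof.
move=> c d /(congr1 sval) /= cd.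
apply: eq_sig_hprop; first by move=> ? ? ?; exact: Prop_irrelevance.
apply: eq_sig_hprop; first by move=> ? ? ?; exact: Prop_irrelevance.
apply/funext => T; apply/propext.
by split=> /(ext_classP (class_representative_in _)) Tlim;
  apply/(ext_classP (class_representative_in _)); rewrite Tlim.
Qed.

Lemma class_limit_surjective (C : nonempty_clopen Z) :
  exists c, class_limit c = C.
Proof.
case: C => C [cC C0]; have [T lcT TC] := clopen_limit_set sc lcX zdK cC C0.
pose c0 : ext_classes X := exist _ (ext_class T) (ex_intro _ T erefl).
have c0T : sval c0 T := iffRL (ext_equivP T T) erefl.
pose c : lc_ext_classes X := exist _ c0 (ex_intro _ T (conj c0T lcT)).
exists c; apply: nonempty_clopen_eq => /=.
rewrite -TC; apply/(ext_classP c0T).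
exact: (class_representative_in c).
Qed.

Lemma class_limit_le c d :
  lc_ext_classes_le c d <-> clopen_ge (class_limit c) (class_limit d).
Proof.
split=> [[S [T [Sc Td /(ext_leP sc) ST]]]|cd]; last first.
  exists (class_representative c), (class_representative d).
  by split; [exact: class_representative_in..|exact/(ext_leP sc)].
rewrite /clopen_ge /=.
by rewrite -(iffLR (ext_classP (class_representative_in c) S) Sc)
  -(iffLR (ext_classP (class_representative_in d) T) Td).
Qed.

Lemma lc_ext_classes_clopens :
  order_isomorphic (@lc_ext_classes_le X) (@clopen_ge Z).
Proof.
exact: order_embedding_isomorphic class_limit_injective class_limit_surjective
  class_limit_le.
Qed.

End ClassesAsClopens.

(** * Stone duality for nonempty clopen sets *)

Lemma clopen_base_eq (Z : topologicalType) (x y : Z) :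
  hausdorff_space Z -> has_clopen_base Z ->
  (forall C, clopen C -> C x -> C y) -> x = y.
Proof.
move=> hZ bZ xy; apply: hZ => U V /bZ[C [cC Cx CU]] yV.
by exists y; split; [exact/CU/(xy C)|exact: nbhs_singleton].
Qed.

Lemma clopen_base_set_type (K : topologicalType) (A : set K) :
  has_clopen_base K -> has_clopen_base A.
Proof.
move=> bK x U /set_val_reflects_nbhs[W /bK[V [cV Vx VW]] WU].
exists (set_val @^-1` V); split=> // [|y /VW/WU//].
exact: preimage_clopen cV (@set_val_continuous _ _).
Qed.

Section ClopenIso.
Context {Z W : topologicalType}.
Variables (phi : nonempty_clopen Z -> nonempty_clopen W)
  (psi : nonempty_clopen W -> nonempty_clopen Z).
Hypothesis phiK : cancel phi psi.
Hypotheses (phi_ge : forall C D, clopen_ge C D -> clopen_ge (phi C) (phi D))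
  (psi_ge : forall C D, clopen_ge C D -> clopen_ge (psi C) (psi D)).

(** Two sets meet exactly if they have a common nonempty clopen subset, which
    the order sees. *)
Lemma clopen_iso_meet C D :
  sval (phi C) `&` sval (phi D) !=set0 -> sval C `&` sval D !=set0.
Proof.
move=> CD0; have cCD : clopen (sval (phi C) `&` sval (phi D)).
  by apply: clopenI; [case: (svalP (phi C))|case: (svalP (phi D))].
pose E : nonempty_clopen W := exist _ _ (conj cCD CD0).
have [_ [z Ez]] := svalP (psi E); exists z; split.
- by rewrite -(phiK C); apply: psi_ge Ez => w [].
- by rewrite -(phiK D); apply: psi_ge Ez => w [].
Qed.

(** The images of the clopen neighbourhoods of [z] have the finite intersection
    property, so they meet in some [w]. If [w] is in the image of [C] but [z]
    is not in [C], then the images of [C] and of its complement meet. *)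
Lemma clopen_iso_point (z : Z) : compact [set: W] ->
  exists w : W, forall C, sval C z <-> sval (phi C) w.
Proof.
move=> cW; pose F := filter_from [set C | sval C z] (fun C => sval (phi C)).
have FF : ProperFilter F.
  apply: filter_from_proper => [|C _]; last by have [] := svalP (phi C).
  apply: filter_from_filter.
    have T0 : [set: Z] !=set0 by exists z.
    by exists (exist _ setT (conj clopenT T0)).
  move=> C D Cz Dz; have cCD : clopen (sval C `&` sval D).
    by apply: clopenI; [case: (svalP C)|case: (svalP D)].
  have CD0 : sval C `&` sval D !=set0 by exists z.
  pose E : nonempty_clopen Z := exist _ _ (conj cCD CD0).
  exists E => // w Ew; split.
  - by apply: (phi_ge (C := C) (D := E)) => // y [].
  - by apply: (phi_ge (C := D) (D := E)) => // y [].
have [w [_ clw]] := cW F FF filterT.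
have in_phi C : sval C z -> sval (phi C) w.
  move=> Cz; have [[_ clC] _] := svalP (phi C).
  by apply: clC => U wU; apply: clw wU; exists C.
exists w => C; split=> [|Cw]; first exact: in_phi.
apply: contrapT => nCz; have cC' : clopen (~` sval C).
  by apply: (@clopenC _ _ set0); case: (svalP C).
have C'0 : ~` sval C !=set0 by exists z.
pose C' : nonempty_clopen Z := exist _ _ (conj cC' C'0).
have [|y [Cy]] := @clopen_iso_meet C C'; last by apply.
by exists w; split=> //; exact: in_phi.
Qed.

End ClopenIso.

(** The preimage of a clopen set [D] is [psi D]. *)
Lemma clopen_point_map_continuous (Z W : topologicalType)
    (phi : nonempty_clopen Z -> nonempty_clopen W)
    (psi : nonempty_clopen W -> nonempty_clopen Z) (f : Z -> W) :
  has_clopen_base W -> cancel psi phi ->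
  (forall z C, sval C z <-> sval (phi C) (f z)) -> continuous f.
Proof.
move=> bW psiK fP z U /bW[D [cD Dz DU]].
have D0 : D !=set0 by exists (f z).
pose E : nonempty_clopen W := exist _ D (conj cD D0).
have [[oE _] _] := svalP (psi E).
have inE y : sval (psi E) y <-> D (f y) by rewrite fP psiK.
apply: (@filterS _ (nbhs z) _ (sval (psi E))) => [y /inE/DU//|].
by apply: open_nbhs_nbhs; split=> //; apply/inE.
Qed.

Lemma nonempty_clopen_homeomorphic (Z W : topologicalType) :
  hausdorff_space Z -> compact [set: Z] -> has_clopen_base Z ->
  hausdorff_space W -> compact [set: W] -> has_clopen_base W ->
  order_isomorphic (@clopen_ge Z) (@clopen_ge W) <-> homeomorphic Z W.
Proof.
move=> hZ cZ bZ hW cW bW; split; last first.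
  move=> [f [cf [g [cg fg gf]]]].
  have pre (A B : topologicalType) (h : A -> B) (k : B -> A) :
      continuous h -> cancel k h ->
      forall C : nonempty_clopen B,
        clopen (h @^-1` sval C) /\ (h @^-1` sval C) !=set0.
    move=> ch kh [C [cC [b Cb]]] /=; split; first exact: preimage_clopen.
    by exists (k b); rewrite /= kh.
  pose phi C : nonempty_clopen W :=
    exist _ (g @^-1` sval C) (pre _ _ _ _ cg fg C).
  pose psi D : nonempty_clopen Z :=
    exist _ (f @^-1` sval D) (pre _ _ _ _ cf gf D).
  exists phi, psi; split.
  - move=> C; apply: nonempty_clopen_eq.
    by apply/funext => z /=; rewrite fg.
  - move=> D; apply: nonempty_clopen_eq.
    by apply/funext => w /=; rewrite gf.
  - by move=> C D CD w /= /CD.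
  - by move=> C D CD z /= /CD.
move=> [phi [psi [phiK psiK phi_ge psi_ge]]].
pose f z := sval (cid (clopen_iso_point phiK phi_ge psi_ge z cW)).
have fP z C : sval C z <-> sval (phi C) (f z).
  exact: (svalP (cid (clopen_iso_point phiK phi_ge psi_ge z cW))).
pose g w := sval (cid (clopen_iso_point psiK psi_ge phi_ge w cZ)).
have gP w D : sval D w <-> sval (psi D) (g w).
  exact: (svalP (cid (clopen_iso_point psiK psi_ge phi_ge w cZ))).
exists f; split; first exact: (clopen_point_map_continuous bW psiK fP).
exists g; split; first exact: (clopen_point_map_continuous bZ phiK gP).
- move=> z; symmetry; apply: clopen_base_eq => // C cC Cz.
  have C0 : C !=set0 by exists z.
  pose E : nonempty_clopen Z := exist _ C (conj cC C0).
  by have : sval E (g (f z)) by rewrite -(phiK E) -gP -fP.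
- move=> w; symmetry; apply: clopen_base_eq => // D cD Dw.
  have D0 : D !=set0 by exists w.
  pose E : nonempty_clopen W := exist _ D (conj cD D0).
  by have : sval E (f (g w)) by rewrite -(psiK E) -fP -gP.
Qed.

(** * Locally compact extensions and the remainder *)

Theorem theorem2p7 (R : realType) (X Y : topologicalType)
    (lcX : locally_compact_space X) (szX : strongly_zero_dimensional R X)
    (lcY : locally_compact_space Y) (szY : strongly_zero_dimensional R Y) :
  order_isomorphic (@lc_ext_classes_le X) (@lc_ext_classes_le Y) <->
  homeomorphic (stone_cech_remainder R X) (stone_cech_remainder R Y).
Proof.
have [tX zdX] := szX; have [tY zdY] := szY.
have scX := stone_cech_mapP (R := R) tX.
have scY := stone_cech_mapP (R := R) tY.
have isoX := lc_ext_classes_clopens scX lcX zdX.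
have isoY := lc_ext_classes_clopens scY lcY zdY.
have stone := nonempty_clopen_homeomorphic
  (remainder_hausdorff scX) (remainder_compact scX lcX)
  (clopen_base_set_type zdX)
  (remainder_hausdorff scY) (remainder_compact scY lcY)
  (clopen_base_set_type zdY).
apply: iff_trans stone; split=> iso.
  exact: order_isomorphic_trans (order_isomorphic_trans
    (order_isomorphic_sym isoX) iso) isoY.
exact: order_isomorphic_trans (order_isomorphic_trans isoX iso)
  (order_isomorphic_sym isoY).
Qed.
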